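(* There exist absolute constants $C_1,C_2>0$ such that the following holds. Let $n$ and $t$ be positive integers with $t<n$, and let $H$ be the square board $G_n=\{1,\dots,n\}^2$ equipped with one switch for each horizontal line $\{y=i\}$, $i=1,\dots,n$, and one switch for each line of slope $t$ (i.e. each line $\{y=tx+b\}$) that contains at least one point of $G_n$. Then $C_1\, n^{3/2}t^{1/2}\le F(H)\le C_2\, n^{3/2}t^{1/2}$, i.e. the maximum discrepancy of $H$ is $\Theta(n^{3/2}t^{1/2})$.
   Context: General switching game: a board is a finite set $H$ of lattice points together with a family of lines, each carrying a switch. An initial configuration assigns $a_p\in\{-1,+1\}$ to each $p\in H$; a switch setting assigns $s_L\in\{-1,+1\}$ to each switched line $L$. The light at $p$ then has value $a_p\prod_{L\ni p}s_L$ (product over switched lines containing $p$), and the signed discrepancy is the sum of these values over $p\in H$. The maximum discrepancy $F(H)$ is the minimum over all initial configurations of the maximum over all switch settings of the signed discrepancy. *)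

(* Defs.v *)
From mathcomp Require Import all_boot all_order all_algebra finmap.

Set Implicit Arguments.
Unset Strict Implicit.
Unset Printing Implicit Defensive.

Import Order.TTheory GRing.Theory Num.Theory.
Local Open Scope ring_scope.

Definition point : choiceType := (int * int)%type.

Section SwitchingGame.

(* Only the lattice points of a line matter, so the switched lines are an
   indexed family of predicates on lattice points; there is one switch per
   index. *)
Variables (H : {fset point}) (I : finType) (L : I -> pred point).

(* Elements of {-1, +1} are encoded by booleans: b stands for (-1) ^+ b. *)
Definition configuration := {ffun H -> bool}.
Definition setting := {ffun I -> bool}.

Definition light (a : configuration) (s : setting) (p : H) : int :=
  (-1) ^+ a p * \prod_(i | L i (val p)) (-1) ^+ s i.

Definition signed_disc (a : configuration) (s : setting) : int :=
  \sum_(p : H) light a s p.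

(* The starting values of the iterated max and min below are values attained
   at an actual setting, resp. configuration, so these are the true maximum
   and minimum (see max_over_settingsP and max_discrepancyP). *)
Definition max_over_settings (a : configuration) : int :=
  \big[Num.max/signed_disc a [ffun=> false]]_(s : setting) signed_disc a s.

Definition max_discrepancy : int :=
  \big[Num.min/max_over_settings [ffun=> false]]_(a : configuration)
     max_over_settings a.

Lemma max_over_settingsP (a : configuration) :
  (forall s, signed_disc a s <= max_over_settings a) /\
  (exists s, max_over_settings a = signed_disc a s).
Proof.
split=> [s|]; first exact: le_bigmax.
rewrite /max_over_settings; elim/big_ind: _ => [|x y [s ->] [s' ->]|s _].
- by exists [ffun=> false].
- by case: leP => _; [exists s' | exists s].
- by exists s.
Qed.

Lemma max_discrepancyP :
  (forall a, max_discrepancy <= max_over_settings a) /\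
  (exists a, max_discrepancy = max_over_settings a).
Proof.
split=> [a|]; first exact: bigmin_le_cond.
rewrite /max_discrepancy; elim/big_ind: _ => [|x y [a ->] [a' ->]|a _].
- by exists [ffun=> false].
- by case: leP => _; [exists a | exists a'].
- by exists a.
Qed.

End SwitchingGame.

Definition grid (n : nat) : {fset point} :=
  [fset ((x%:Z, y%:Z) : point) | x in iota 1 n, y in iota 1 n]%fset.

Lemma in_grid (n : nat) (p : point) :
  (p \in grid n) = (1 <= p.1 <= n%:Z) && (1 <= p.2 <= n%:Z).
Proof.
apply/imfset2P/idP => /= [[x xn [y yn ->]] /=|].
  by move: xn yn; rewrite !mem_iota !lez_nat !add1n !ltnS => -> ->.
case: p => [[x|x] [y|y]] //=; rewrite ?andbF // !lez_nat => /andP[xn yn].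
by exists x; [|exists y]; rewrite // ?inE ?mem_iota ?add1n ?ltnS.
Qed.

Definition horizontal_line (i : int) : pred point := fun p => p.2 == i.

Definition sloped_line (t : nat) (b : int) : pred point :=
  fun p => p.2 == t%:Z * p.1 + b.

(* The b such that the line y = t x + b meets the grid, obtained as the
   intercepts of the lines of slope t through the points of the grid. *)
Definition intercepts (n t : nat) : {fset int} :=
  [fset p.2 - t%:Z * p.1 | p in grid n]%fset.

Lemma interceptsP (n t : nat) (b : int) :
  reflect (exists2 p, p \in grid n & sloped_line t b p) (b \in intercepts n t).
Proof.
apply: (iffP (imfsetP _ _ _ _)) => /= -[p pG].
  by move=> ->; exists p; rewrite // /sloped_line addrC subrK.
by rewrite /sloped_line => /eqP e; exists p; rewrite // e addrC addKr.
Qed.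

Definition board_lines (n t : nat)
    (l : 'I_n + intercepts n t) : pred point :=
  match l with
  | inl i => horizontal_line i.+1%:Z
  | inr b => sloped_line t (val b)
  end.

Definition board_discrepancy (n t : nat) : int :=
  max_discrepancy (grid n) (@board_lines n t).

(* Main.v *)
Require Import Defs.
From mathcomp Require Import all_boot all_order all_algebra finmap.
From mathcomp Require Import all_classical all_reals all_analysis.
From mathcomp Require Import ring lra zify.

(* Upper bound: the t-slope lines number O(tn), so a union bound over the
   2^O(tn) settings with the sub-Gaussian tail of a random configuration gives
   max discrepancy O(n sqrt(tn)). Lower bound: choose the row switches at
   random and each sloped switch optimally. A sloped line with k points meets k
   distinct rows, so its expected absolute sum is of order sqrt k >= k / sqrt K,
   where K = 2n/t bounds the number of points of every such line; the k add up
   to n^2. *)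

Set Implicit Arguments.
Unset Strict Implicit.
Unset Printing Implicit Defensive.

Import Order.TTheory GRing.Theory Num.Theory.
Local Open Scope ring_scope.

(** * Moments of random sign sums *)

Lemma sum_flip (V : nmodType) (J : finType) (j : J)
    (f : {ffun J -> bool} -> V) :
  \sum_r f r = \sum_(r : {ffun J -> bool}) f [ffun i => r i (+) (i == j)].
Proof.
apply: (reindex_inj (can_inj (g := fun r : {ffun J -> bool} => [ffun i => r i (+) (i == j)]) _)).
by move=> r; apply/ffunP => i; rewrite !ffunE addbK.
Qed.

Section SignSum.
Variables (R : realFieldType) (J T : finType) (row : T -> J) (c : T -> R).
Hypothesis c2 : forall p, c p ^+ 2 = 1.

(** The row signs [r] act as uniformly random: a sum over all [r] is [2 ^+ #|J|] times an
    expectation. *)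
Definition sign_sum (s : seq T) (r : {ffun J -> bool}) : R :=
  \sum_(p <- s) c p * (-1) ^+ r (row p).

Lemma sign_sum_flip p s (r : {ffun J -> bool}) : row p \notin map row s ->
  sign_sum s [ffun i => r i (+) (i == row p)] = sign_sum s r.
Proof.
move=> ps; apply: eq_big_seq => x xs; rewrite ffunE.
by rewrite (negPf (memPn ps _ (map_f row xs))) addbF.
Qed.

(** Pairing each [r] with its flip at [row p] leaves the sum over [s] fixed, since no point of [s]
    is in that row, and gives the new term both signs. *)
Lemma sum_sign_sum_cons (g : R -> R) p s : row p \notin map row s ->
  2 * (\sum_r g (sign_sum (p :: s) r)) =
  \sum_r (g (sign_sum s r + c p) + g (sign_sum s r - c p)).
Proof.
move=> ps; rewrite mulr_natl mulr2n {2}(sum_flip (row p)) -big_split /=.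
apply: eq_bigr => r _; rewrite /sign_sum !big_cons -/(sign_sum s r).
rewrite -/(sign_sum s [ffun i => r i (+) (i == row p)]) sign_sum_flip //.
rewrite ffunE eqxx addbT; case: (r (row p)) => /=.
  by rewrite expr0 expr1 mulr1 mulrN1 addrC [c p + _]addrC [- c p + _]addrC addrC.
by rewrite expr0 expr1 mulr1 mulrN1 [c p + _]addrC [- c p + _]addrC.
Qed.

Lemma sum_sign_sum2 s : uniq (map row s) ->
  \sum_r sign_sum s r ^+ 2 = 2 ^+ #|J| * (size s)%:R.
Proof.
elim: s => [_|p s IH /= /andP[ps us]].
  rewrite mulr0 big1 // => r _; by rewrite /sign_sum big_nil expr0n.
have := sum_sign_sum_cons (fun x => x ^+ 2) ps.
rewrite [X in _ = X -> _](eq_bigr (fun r => 2 * sign_sum s r ^+ 2 + 2)); last first.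
  by move=> r _; rewrite /= sqrrB sqrrD c2; ring.
rewrite big_split /= -mulr_sumr IH // sumr_const card_ffun card_bool.
rewrite -[in X in _ = X -> _](mulr_natl 2) natrX -natr1.
by move=> e; apply: (mulfI (_ : 2 != 0 :> R)); rewrite ?pnatr_eq0 // e; ring.
Qed.

(** With k points already present, a new one raises the mean fourth power by 6k + 1, less than the
    increment 6k + 3 of 3k^2. *)
Lemma sum_sign_sum4 s : uniq (map row s) ->
  \sum_r sign_sum s r ^+ 4 <= 2 ^+ #|J| * (3 * (size s)%:R ^+ 2).
Proof.
elim: s => [_|p s IH /= /andP[ps us]].
  rewrite expr0n /= !mulr0 big1 // => r _; by rewrite /sign_sum big_nil expr0n.
have := sum_sign_sum_cons (fun x => x ^+ 4) ps.
rewrite [X in _ = X -> _](eq_bigr (fun r => 2 * sign_sum s r ^+ 4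
                           + (12 * sign_sum s r ^+ 2 + 2))); last first.
  move=> r _; set x := sign_sum s r.
  transitivity (2 * x ^+ 4 + (12 * x ^+ 2 * c p ^+ 2 + 2 * c p ^+ 2 ^+ 2)).
    ring.
  by rewrite c2; ring.
rewrite 2!big_split /= -!mulr_sumr sum_sign_sum2 // sumr_const card_ffun.
rewrite card_bool -[in X in _ = X -> _](mulr_natl 2) natrX -natr1 => e.
have := IH us; have : 0 <= 2 ^+ #|J| :> R by rewrite exprn_ge0.
set N := 2 ^+ #|J| in e *; set k := (size s)%:R in e *; nra.
Qed.

(* With y = |x| / q the claim is y (y - 1)^2 (y + 2) >= 0. *)
Lemma norm_ge_quartic (q x : R) : 0 < q ->
  3 * q ^+ 2 * x ^+ 2 - x ^+ 4 <= 2 * q ^+ 3 * `|x|.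
Proof.
move=> q0; rewrite -(real_normK (num_real x)) -subr_ge0.
have -> : x ^+ 4 = `|x| ^+ 4.
  by rewrite -[4%N]/(2 * 2)%N !exprM real_normK ?num_real.
move: `|x| (normr_ge0 x) => y y0.
rewrite (_ : _ - _ = y * (y - q) ^+ 2 * (y + 2 * q)); last by ring.
have ? : 0 <= y + 2 * q by lra.
by rewrite mulr_ge0 // mulr_ge0 // sqr_ge0.
Qed.

(** Averaging the quartic inequality bounds the first absolute moment by the second and fourth ones.
    As [2 * size s <= q ^+ 2], the fourth moment cancels at most half of the second-moment term. *)
Lemma sum_norm_sign_sum_ge (q : R) s : 0 < q -> uniq (map row s) ->
  2 * (size s)%:R <= q ^+ 2 ->
  2 ^+ #|J| * (3 * (size s)%:R) <= 4 * q * \sum_r `|sign_sum s r|.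
Proof.
move=> q0 us sq.
have : \sum_r (3 * q ^+ 2 * sign_sum s r ^+ 2 - sign_sum s r ^+ 4)
       <= \sum_r 2 * q ^+ 3 * `|sign_sum s r|.
  by apply: ler_sum => r _; exact: norm_ge_quartic.
rewrite big_split /= -!mulr_sumr sum_sign_sum2 // sumrN.
have := sum_sign_sum4 us; set A := \sum_r _ ^+ 4; set B := \sum_r `|_|.
have N0 : 0 <= 2 ^+ #|J| :> R by rewrite exprn_ge0.
have k0 : 0 <= (size s)%:R :> R by [].
move: N0 k0 sq; set N := 2 ^+ #|J|; set k := (size s)%:R => N0 k0 sq hA h.
have q2 : 0 < q ^+ 2 by rewrite exprn_gt0.
rewrite -(ler_pM2l q2); have Nk := mulr_ge0 N0 k0.
have := ler_wpM2l Nk sq; nra.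
Qed.

End SignSum.

Lemma exists_ge_mean (R : realFieldType) (T : finType) (x : R) (f : T -> R) :
  (0 < #|T|)%N -> #|T|%:R * x <= \sum_i f i -> exists i, x <= f i.
Proof.
move=> T0 h; apply/existsP; apply: contraLR h => /existsPn h.
rewrite -ltNge mulr_natl -sumr_const; apply: ltr_sum => [|i _].
  by have /card_gt0P[i _] := T0; apply/hasP; exists i; rewrite ?mem_index_enum.
by rewrite ltNge h.
Qed.

(** Injectivity puts the points of a class of [col] in distinct rows, so the moment bound applies to
    each class. A common [q] lets the class sizes add up to [#|T|]. *)
Lemma exists_row_signs (R : realFieldType) (J B T : finType)
    (row : T -> J) (col : T -> B) (c : T -> R) (q : R) :
  (forall p, c p ^+ 2 = 1) -> 0 < q ->
  injective (fun p => (row p, col p)) ->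
  (forall b, 2 * #|[pred p | col p == b]|%:R <= q ^+ 2) ->
  exists r : {ffun J -> bool},
    3 * #|T|%:R <= 4 * q *
      \sum_b `|\sum_(p | col p == b) c p * (-1) ^+ r (row p)|.
Proof.
move=> c2 q0 inj small; apply: exists_ge_mean.
  by rewrite card_ffun card_bool expn_gt0.
have -> : #|T| = \sum_b #|[pred p | col p == b]|.
  rewrite -sum1_card (partition_big col predT) //.
  by apply: eq_bigr => b _; rewrite -sum1_card.
rewrite card_ffun card_bool natrX natr_sum !mulr_sumr -[leRHS]mulr_sumr.
rewrite exchange_big mulr_sumr /=; apply: ler_sum => b _.
set s := enum [pred p | col p == b].
have us : uniq (map row s).
  rewrite map_inj_in_uniq ?enum_uniq // => x y.
  rewrite !mem_enum !inE => /eqP xb /eqP yb xy.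
  by apply: inj; rewrite xy xb yb.
have sq : 2 * (size s)%:R <= q ^+ 2 by rewrite -cardE small.
have := sum_norm_sign_sum_ge c2 q0 us sq; rewrite -cardE => h.
apply: le_trans h _.
rewrite le_eqVlt; apply/orP; left; apply/eqP; congr (_ * _).
by apply: eq_bigr => r _; rewrite /sign_sum big_enum.
Qed.

(** * Exponential moments and the general upper bound *)

(** From e^y <= 1/(1 - y) the left side is at most 2/(1 - x^2), which is at most 2(1 + 2x^2) for
    small x. *)
Lemma expR_add_expRN_le (R : realType) (x : R) : 0 < x -> x <= 2^-1 ->
  expR x + expR (- x) <= 2 * expR (2 * x ^+ 2).
Proof.
have expR_le (y : R) : -1 < y < 1 -> expR y <= (1 - y)^-1.
  move=> /andP[y1 y2]; rewrite -[y in leLHS]opprK expRN.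
  by rewrite lef_pV2 ?posrE ?expR_gt0 ?subr_gt0 ?expR_ge1Dx.
move=> x0 x2; have h1 : expR x <= (1 - x)^-1 by apply: expR_le; lra.
have h2 : expR (- x) <= (1 - - x)^-1 by apply: expR_le; lra.
apply: le_trans (lerD h1 h2) _.
have h3 : 2 * (1 + 2 * x ^+ 2) <= 2 * expR (2 * x ^+ 2).
  by rewrite ler_pM2l ?expR_ge1Dx.
apply: le_trans h3; have x4 : x ^+ 2 <= 4^-1 by nra.
have d : 0 < 1 - x ^+ 2 by lra.
have -> : (1 - x)^-1 + (1 - - x)^-1 = 2 / (1 - x ^+ 2).
  by field; rewrite !gt_eqF //; lra.
rewrite ler_pdivrMr //; have := sqr_ge0 x; nra.
Qed.

Lemma intr_light (R : realType) (H : {fset Defs.point}) (I : finType)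
    (L : I -> pred Defs.point) a s (p : H) :
  (light L a s p)%:~R =
  (-1) ^+ (a p (+) \big[addb/false]_(i | L i (val p)) s i) :> R.
Proof.
rewrite /light -(@big_morph _ _ _ 1 *%R false addb (@signr_addb int) erefl).
by rewrite -signr_addb rmorph_sign.
Qed.

(* Markov's inequality for the exponential moment of a random configuration,
   with a union bound over all settings. *)
Lemma max_discrepancy_le (R : realType) (H : {fset Defs.point}) (I : finType)
    (L : I -> pred Defs.point) (x : R) : 0 < x -> x <= 2^-1 ->
  (max_discrepancy H L)%:~R <= #|I|%:R / x + 2 * x * #|{: H}|%:R.
Proof.
move=> x0 x2; set F := max_discrepancy H L.
(* For a fixed setting the lights are independent random signs, so the moment factors over the
   points; the switch parity [S p] only swaps e^x and e^-x. *)
have mgf s : \sum_(a : configuration H) expR (x * (signed_disc L a s)%:~R)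
             = (expR x + expR (- x)) ^+ #|{: H}|.
  rewrite -prodr_const.
  pose S (p : H) := \big[addb/false]_(i | L i (val p)) s i.
  under [RHS]eq_bigr => p _.
    have -> : expR x + expR (- x) = \sum_b expR (x * (-1) ^+ (b (+) S p)).
      rewrite big_bool; case: (S p); rewrite /= expr0 expr1 mulr1 mulrN1 //.
      by rewrite addrC.
    over.
  rewrite bigA_distr_bigA; apply: eq_bigr => a _ /=.
  rewrite -expR_sum -mulr_sumr /signed_disc rmorph_sum /=.
  by congr (expR (_ * _)); apply: eq_bigr => p _; rewrite intr_light.
(* Each configuration has a setting of discrepancy at least [F]; only that term is kept. *)
have lower : 2 ^+ #|{: H}| * expR (x * F%:~R) <=
    \sum_(a : configuration H) \sum_(s : setting I)
      expR (x * (signed_disc L a s)%:~R).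
  have -> : 2 ^+ #|{: H}| = #|configuration H|%:R :> R.
    by rewrite card_ffun card_bool natrX.
  rewrite mulr_natl -sumr_const; apply: ler_sum => a _.
  have [s e] := (max_over_settingsP L a).2.
  rewrite (bigD1 s) //= -[leLHS]addr0; apply: lerD; last first.
    by apply: sumr_ge0 => s' _; exact: expR_ge0.
  by rewrite ler_expR ler_pM2l // ler_int -e (max_discrepancyP H L).1.
move: lower; rewrite exchange_big /=; under eq_bigr => s _ do rewrite mgf.
rewrite sumr_const card_ffun card_bool -[leRHS]mulr_natl natrX => lower.
(* The number of settings is absorbed through 2 = 1 + 1 <= e. *)
have upper : 2 ^+ #|I| * (expR x + expR (- x)) ^+ #|{: H}| <=
    expR #|I|%:R * (2 ^+ #|{: H}| * expR (2 * x ^+ 2 * #|{: H}|%:R)).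
  apply: ler_pM; rewrite ?exprn_ge0 ?addr_ge0 ?expR_ge0 //.
    rewrite -[#|I|%:R]mulr1 expRM_natl lerXn2r ?nnegrE ?expR_ge0 //.
    by have := expR_ge1Dx (1 : R).
  rewrite [_ * #|{: H}|%:R]mulrC expRM_natl -exprMn.
  by rewrite lerXn2r ?nnegrE ?addr_ge0 ?mulr_ge0 ?expR_ge0 ?expR_add_expRN_le.
have := le_trans lower upper; rewrite mulrCA ler_pM2l ?exprn_gt0 //.
rewrite -expRD ler_expR => h.
rewrite -(ler_pM2l x0); apply: le_trans h _.
rewrite le_eqVlt; apply/orP; left; apply/eqP; field; exact: lt0r_neq0.
Qed.

(** * Rows and sloped lines of the grid *)

Lemma grid_bounds n (p : grid n) : [/\ 1 <= (fsval p).1, (fsval p).1 <= n%:Z,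
  1 <= (fsval p).2 & (fsval p).2 <= n%:Z].
Proof. by have := fsvalP p; rewrite in_grid => /andP[/andP[? ?] /andP[? ?]]. Qed.

Lemma grid_row_subproof n (p : grid n) : (`|(fsval p).2|.-1 < n)%N.
Proof. by have [] := grid_bounds p; lia. Qed.

Definition grid_row n (p : grid n) : 'I_n := Ordinal (grid_row_subproof p).

Lemma horizontal_line_grid n (i : 'I_n) (p : grid n) :
  horizontal_line i.+1%:Z (val p) = (i == grid_row p).
Proof.
have [_ _ h1 h2] := grid_bounds p.
rewrite /horizontal_line -val_eqE /=; move: (fsval p).2 h1 h2; lia.
Qed.

Lemma grid_intercept_subproof n t (p : grid n) :
  (fsval p).2 - t%:Z * (fsval p).1 \in intercepts n t.
Proof.
apply/interceptsP; exists (val p); first exact: valP.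
by rewrite /sloped_line addrC subrK.
Qed.

Definition grid_intercept n t (p : grid n) : intercepts n t :=
  [` grid_intercept_subproof t p]%fset.

Lemma sloped_line_grid n t (b : intercepts n t) (p : grid n) :
  sloped_line t (val b) (val p) = (b == grid_intercept t p).
Proof. by rewrite /sloped_line -val_eqE /= [RHS]eq_sym subr_eq addrC. Qed.

(** Each grid point lies on exactly one horizontal and one sloped line, so two switches remain in
    the product. *)
Lemma intr_board_light (R : realType) n t (a : configuration (grid n))
    (s : setting ('I_n + intercepts n t)%type) (p : grid n) :
  (light (@board_lines n t) a s p)%:~R = (-1) ^+ a p *
    (-1) ^+ s (inl (grid_row p)) * (-1) ^+ s (inr (grid_intercept t p)) :> R.
Proof.
rewrite intr_light big_sumType /= !signr_addb mulrA.
rewrite (big_pred1 (grid_row p)) => [|i]; last exact: horizontal_line_grid.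
by rewrite (big_pred1 (grid_intercept t p)) // => b; exact: sloped_line_grid.
Qed.

Lemma card_grid n : #|{: grid n}| = (n * n)%N.
Proof.
have memf (ij : 'I_n * 'I_n) :
    (ij.1.+1%:Z, ij.2.+1%:Z) \in grid n.
  by rewrite in_grid /= !lez_nat !ltn_ord.
have colP (p : grid n) : (`|(fsval p).1|.-1 < n)%N.
  by have [] := grid_bounds p; lia.
have <- : #|{: 'I_n * 'I_n}| = (n * n)%N by rewrite card_prod card_ord.
apply/esym/(@bij_eq_card _ _ (fun ij => [` memf ij]%fset)).
exists (fun p => (Ordinal (colP p), grid_row p)) => [[i j]|p].
  by congr (_, _); apply: val_inj.
have [x1 _ y1 _] := grid_bounds p; apply: val_inj => /=.
by case: (fsval p) x1 y1 => x y /= x1 y1; congr (_, _); lia.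
Qed.

Lemma grid_row_intercept_inj n t : (0 < t)%N ->
  injective (fun p : grid n => (grid_row p, grid_intercept t p)).
Proof.
move=> t0 p q [].
have [_ _ h1 _] := grid_bounds p.
have [_ _ h2 _] := grid_bounds q.
move=> e1 e2; apply: val_inj => /=; case: (fsval p) (fsval q) h1 h2 e1 e2.
move=> x y [x' y'] /= h1 h2 e1 e2; congr (_, _); nia.
Qed.

(** Adding tn to an intercept y - tx lands in the range from 0 to n + tn. *)
Lemma card_intercepts_le n t : (#|{: intercepts n t}| <= (n + t * n).+1)%N.
Proof.
rewrite -[leqRHS]card_ord.
have inI (b : intercepts n t) :
    0 <= fsval b + (t * n)%:Z /\ fsval b + (t * n)%:Z <= (n + t * n)%:Z.
  have /interceptsP[[x y]] := fsvalP b; rewrite in_grid /sloped_line /=.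
  by move=> /andP[/andP[h1 h2] /andP[h3 h4]] /eqP e; nia.
apply: (leq_card (fun b : intercepts n t => inord `|fsval b + (t * n)%:Z|)).
move=> b b' /(congr1 val) /=.
have [b1 b2] := inI b; have [b3 b4] := inI b'.
rewrite !inordK; [|lia|lia] => e; apply: val_inj => /=.
by move: (fsval b) (fsval b') b1 b2 b3 b4 e; lia.
Qed.

(** Points of one line differ in height by multiples of t, so each block of t consecutive rows
    contains at most one of them. *)
Lemma card_sloped_line_le n t (b : intercepts n t) : (0 < t)%N ->
  (#|[pred p : grid n | grid_intercept t p == b]| <= (n %/ t).+1)%N.
Proof.
move=> t0; rewrite -[leqRHS]card_ord.
have lenk (p : grid n) : (`|(fsval p).2|.-1 %/ t <= n %/ t)%N.
  by rewrite leq_div2r // ltnW // grid_row_subproof.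
apply: (leq_card_in (fun p : grid n => inord (grid_row p %/ t))).
move=> p q; rewrite !inE => /eqP/(congr1 val) /= pb /eqP/(congr1 val) /= qb.
move=> /(congr1 val); rewrite /= !inordK ?ltnS ?lenk //=.
have [_ _ h1 _] := grid_bounds p.
have [_ _ h2 _] := grid_bounds q; move=> e.
have := divn_eq `|(fsval p).2|.-1 t; have := divn_eq `|(fsval q).2|.-1 t.
have := ltn_pmod `|(fsval p).2|.-1 t0; have := ltn_pmod `|(fsval q).2|.-1 t0.
rewrite e => m1 m2 d1 d2.
apply: val_inj => /=; case: (fsval p) (fsval q) h1 h2 pb qb e m1 m2 d1 d2.
move=> x y [x' y'] /= h1 h2 pb qb e m1 m2 d1 d2.
have yy : y - y' < t%:Z /\ y' - y < t%:Z by lia.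
have xx : x = x' by case: (ltgtP x x') => // xx; nia.
by rewrite xx; congr (_, _); lia.
Qed.

(** * The two bounds for the board *)

Section Board.
Variables (R : realType) (n t : nat).
Hypotheses (t0 : (0 < t)%N) (tn : (t < n)%N).
Let u : R := Num.sqrt n%:R.
Let v : R := Num.sqrt t%:R.

Let u0 : 0 < u. Proof. by rewrite sqrtr_gt0 ltr0n; lia. Qed.
Let v0 : 0 < v. Proof. by rewrite sqrtr_gt0 ltr0n. Qed.
Let u2 : u ^+ 2 = n%:R. Proof. exact: sqr_sqrtr. Qed.
Let v2 : v ^+ 2 = t%:R. Proof. exact: sqr_sqrtr. Qed.
Let vu : v <= u. Proof. by rewrite ler_sqrt // ler_nat ltnW. Qed.

Lemma board_discrepancy_le :
  (board_discrepancy n t)%:~R <= 9 * (n%:R * u * v).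
Proof.
(* This choice of x balances the two terms: with at most 4tn switches they become 8nuv and nuv. It
   is at most 1/2 because t < n. *)
have x0 : 0 < v / (2 * u) by rewrite divr_gt0 // mulr_gt0.
have x2 : v / (2 * u) <= 2^-1.
  by rewrite ler_pdivrMr ?mulr_gt0 // mulrA mulVf ?mul1r // pnatr_eq0.
apply: le_trans (max_discrepancy_le (grid n) _ x0 x2) _.
rewrite card_grid card_sum card_ord natrM -u2.
have : (n + #|{: intercepts n t}|)%:R <= 4 * (u ^+ 2 * v ^+ 2).
  rewrite u2 v2 -!natrM ler_nat.
  by have := card_intercepts_le n t; nia.
move/(ler_wpM2r (ltW (_ : 0 < (v / (2 * u))^-1))); rewrite invr_gt0.
move/(_ x0) => h; apply: le_trans (lerD h (lexx _)) _.
rewrite le_eqVlt; apply/orP; left; apply/eqP; field.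
by rewrite !gt_eqF.
Qed.

Lemma board_discrepancy_ge :
  3 / 8 * (n%:R * u * v) <= (board_discrepancy n t)%:~R.
Proof.
(* Here q^2 = 4n/t, which is at least 2(n/t + 1) because t < n. *)
have q0 : 0 < 2 * u / v by rewrite divr_gt0 // mulr_gt0.
rewrite /board_discrepancy.
have [a ->] := (max_discrepancyP (grid n) (@board_lines n t)).2.
have small b : 2 * #|[pred p : grid n | grid_intercept t p == b]|%:R
    <= (2 * u / v) ^+ 2.
  rewrite !exprMn exprVn u2 v2 ler_pdivlMr ?ltr0n // -natrX -!natrM ler_nat.
  by have := card_sloped_line_le b t0; have := leq_divM n t; nia.
have a2 p : (-1 : R) ^+ a p ^+ 2 = 1 by rewrite sqrr_sign.
have [r] := exists_row_signs a2 q0 (grid_row_intercept_inj t0) small.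
set S := fun b => \sum_(p | grid_intercept t p == b)
  (-1) ^+ a p * (-1) ^+ r (grid_row p) : R.
rewrite -/S card_grid => h.
(* Each sloped switch takes the sign of its line sum, so the line contributes [|S b|]. *)
pose s : setting ('I_n + intercepts n t)%type :=
  [ffun l => match l with inl i => r i | inr b => S b < 0 end].
have es : (signed_disc (@board_lines n t) a s)%:~R = \sum_b `|S b|.
  rewrite /signed_disc rmorph_sum (partition_big (grid_intercept t) predT) //=.
  apply: eq_bigr => b _; rewrite normrEsign mulr_sumr.
  by apply: eq_bigr => p /eqP pb; rewrite intr_board_light !ffunE pb mulrC.
have : \sum_b `|S b| <= (max_over_settings (@board_lines n t) a)%:~R.
  by rewrite -es ler_int (max_over_settingsP (@board_lines n t) a).1.
apply: le_trans; move: h; rewrite natrM -u2.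
(* The factor v/(8u) is 1/(4q), which isolates the sum of the [|S b|]. *)
rewrite -(ler_pM2l (_ : 0 < v / (8 * u))); last by rewrite divr_gt0 ?mulr_gt0.
set X := \sum_b _; move=> h; apply: le_trans (le_trans h _);
  rewrite le_eqVlt; apply/orP; left; apply/eqP; field; by rewrite !gt_eqF.
Qed.

End Board.

Theorem theorem4 (R : realType) :
  exists C1 C2 : R, 0 < C1 /\ 0 < C2 /\
    forall n t : nat, (0 < n)%N -> (0 < t)%N -> (t < n)%N ->
      C1 * (n%:R `^ (3%:R / 2%:R) * t%:R `^ (1 / 2%:R))
        <= (board_discrepancy n t)%:~R
      /\ (board_discrepancy n t)%:~R
        <= C2 * (n%:R `^ (3%:R / 2%:R) * t%:R `^ (1 / 2%:R)).
Proof.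
exists (3 / 8), 9; split; first by rewrite divr_gt0.
split=> // n t n0 t0 tn.
(* Splitting the exponent turns n^(3/2) into n times its square root, the form of both bounds. *)
have -> : 3 / 2 = 1 + 2^-1 :> R by field.
rewrite powRD; last by apply/implyP; rewrite pnatr_eq0 -lt0n.
rewrite powRr1 // mul1r !powR12_sqrt //.
by split; [exact: board_discrepancy_ge | exact: board_discrepancy_le].
Qed.
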